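(* Let $K$ be a field and $n\ge 3$. Consider the following bilinear products on $UT_n(K)$ (in each item, the products of pairs of basis elements that are not listed are zero): (1) $\mathbf{I}^1_{i,j}$ for $1<i\le n$, $1\le j<n$: $e_{i-1,i}*e_{j,j+1}=e_{1n}$; (2) $\mathbf{I}^2_i$ for $1\le i<n-1$: $e_{12}*e_{i,i+2}=e_{1n}$, $e_{i,i+1}*e_{i+1,i+2}=e_{2n}$; (3) $\mathbf{I}^3_i$ for $1\le i<n-1$: $e_{i,i+2}*e_{n-1,n}=e_{1n}$, $e_{i,i+1}*e_{i+1,i+2}=e_{1,n-1}$; (4) $\mathbf{I}^4$: $e_{ik}*e_{kj}=e_{ij}$ for all $1\le i<k<j\le n$. If $n>4$, then the interchangeable structures on $UT_n(K)$ are exactly the associative products that are $K$-linear combinations of the products (1), (2), (3), (4). If $n\in\{3,4\}$, then the interchangeable structures on $UT_n(K)$ are exactly the associative products that are $K$-linear combinations of the products (1), (2), (3).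
   Context: $K$ is an arbitrary field; all products are $K$-bilinear. $UT_n(K)$ is the associative algebra of strictly upper triangular $n\times n$ matrices over $K$ with the usual matrix product $\cdot$; it has the $K$-basis of matrix units $e_{ij}$ (also written $e_{i,j}$), $1\le i<j\le n$, with $e_{ij}\cdot e_{kl}=\delta_{jk}e_{il}$. An interchangeable structure on an associative algebra $(A,\cdot)$ is an associative bilinear product $*$ on the vector space $A$ such that $(a\cdot b)*c=(a*b)\cdot c$ and $a\cdot(b*c)=a*(b\cdot c)$ for all $a,b,c\in A$. Linear combinations of products are taken in the vector space of bilinear maps $UT_n(K)\times UT_n(K)\to UT_n(K)$. *)

(* Defs.v *)
From HB Require Import structures.
From mathcomp Require Import all_boot all_order all_algebra.

Set Implicit Arguments.
Unset Strict Implicit.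
Unset Printing Implicit Defensive.

Import GRing.Theory.
Local Open Scope ring_scope.

(* [dot] is understood to be the product of an associative K-algebra, as
   [UT_mul] is by [UT_mulA] and [UT_mul_bilinear]. *)
Definition interchangeable (K : fieldType) (A : lmodType K)
    (dot star : A -> A -> A) : Prop :=
  [/\ bilinear_for *:%R *:%R star,
      associative star,
      forall a b c, star (dot a b) c = dot (star a b) c
    & forall a b c, dot a (star b c) = star a (dot b c)].

Section StrictlyUpperTriangular.

Variables (K : fieldType) (n : nat).

Definition strict_upper : {pred 'M[K]_n} :=
  fun x => [forall i : 'I_n, forall j : 'I_n, (j <= i)%N ==> (x i j == 0)].

Lemma strict_upperP (x : 'M[K]_n) :
  reflect (forall i j : 'I_n, (j <= i)%N -> x i j = 0) (x \in strict_upper).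
Proof.
apply: (iffP forallP) => [h i j le_ji | h i].
  by have /forallP/(_ j)/implyP/(_ le_ji)/eqP := h i.
by apply/forallP => j; apply/implyP => /h ->.
Qed.

Lemma strict_upper_submod_closed : submod_closed strict_upper.
Proof.
split; first by apply/strict_upperP => i j _; rewrite mxE.
move=> a x y /strict_upperP hx /strict_upperP hy.
by apply/strict_upperP => i j le_ji; rewrite !mxE hx // hy // mulr0 addr0.
Qed.

HB.instance Definition _ :=
  GRing.isSubmodClosed.Build K 'M[K]_n strict_upper strict_upper_submod_closed.

Record UT : predArgType := MkUT { UT_val :> 'M[K]_n; _ : UT_val \in strict_upper }.

HB.instance Definition _ := [isSub for UT_val].
HB.instance Definition _ := [Choice of UT by <:].
HB.instance Definition _ := [SubChoice_isSubLmodule of UT by <:].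

Lemma UT_mul_subproof (x y : UT) : UT_val x *m UT_val y \in strict_upper.
Proof.
case: x y => x /strict_upperP hx [y /strict_upperP hy] /=.
apply/strict_upperP => i j le_ji; rewrite mxE big1 // => k _.
have [le_ki|lt_ik] := leqP k i; first by rewrite hx // mul0r.
by rewrite (hy k j) ?mulr0 // (leq_trans le_ji) // ltnW.
Qed.

Definition UT_mul (x y : UT) : UT := MkUT (UT_mul_subproof x y).

Lemma UT_mulA : associative UT_mul.
Proof. by move=> x y z; apply: val_inj; rewrite /= mulmxA. Qed.

Lemma UT_mul_bilinear : bilinear_for *:%R *:%R UT_mul.
Proof.
split=> u a x y; apply: val_inj => /=.
  by rewrite mulmxDl -scalemxAl.
by rewrite mulmxDr -scalemxAr.
Qed.

(* The matrix units are numbered from 1, as in e_{ij} with 1 <= i < j <= n,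
   whereas matrix entries are indexed by 'I_n from 0. For natural numbers i, j
   outside that range, [e i j] is 0. *)
Lemma e_subproof (i j : nat) :
  \matrix_(r < n, s < n) ((r.+1 == i) && (s.+1 == j) && (r < s)%N)%:R
    \in strict_upper.
Proof. by apply/strict_upperP => r s le_sr; rewrite mxE ltnNge le_sr andbF. Qed.

Definition e (i j : nat) : UT := MkUT (e_subproof i j).

Lemma eE (i j : nat) (r s : 'I_n) : (0 < i)%N -> (i < j)%N ->
  UT_val (e i j) r s = ((r.+1 == i) && (s.+1 == j))%:R.
Proof.
move=> i_gt0 lt_ij; rewrite mxE; congr (_%:R); congr nat_of_bool.
by case: eqP => //= ri; case: eqP => //= sj; move: lt_ij; rewrite -ri -sj ltnS.
Qed.

(* The bilinear product * with e_{ij} * e_{kl} = t i j k l for all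
   1 <= i < j <= n and 1 <= k < l <= n (see [product_ofE]); the values of t at
   other indices are irrelevant, the corresponding entries of x or y being 0. *)
Definition product_of (t : nat -> nat -> nat -> nat -> UT) (x y : UT) : UT :=
  \sum_(i < n) \sum_(j < n) \sum_(k < n) \sum_(l < n)
    (UT_val x i j * UT_val y k l) *: t i.+1 j.+1 k.+1 l.+1.

Lemma product_ofE t (i j k l : nat) :
    (0 < i)%N -> (i < j <= n)%N -> (0 < k)%N -> (k < l <= n)%N ->
  product_of t (e i j) (e k l) = t i j k l.
Proof.
case: i j k l => [|i] [|j] [|k] [|l] // _ /andP[lt_ij lt_jn] _ /andP[lt_kl lt_ln].
have lt_in : (i < n)%N by apply: leq_trans lt_jn; rewrite ltnW.
have lt_kn : (k < n)%N by apply: leq_trans lt_ln; rewrite ltnW.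
pose i' := Ordinal lt_in; pose j' := Ordinal lt_jn.
pose k' := Ordinal lt_kn; pose l' := Ordinal lt_ln.
have eij r s : UT_val (e i.+1 j.+1) r s = ((r == i') && (s == j'))%:R by rewrite eE.
have ekl r s : UT_val (e k.+1 l.+1) r s = ((r == k') && (s == l'))%:R by rewrite eE.
rewrite /product_of (bigD1 i') //= [X in _ + X]big1 ?addr0 => [|r /negbTE r_i]; last first.
  by do 3![apply: big1 => ? _]; rewrite eij r_i mul0r scale0r.
rewrite (bigD1 j') //= [X in _ + X]big1 ?addr0 => [|r /negbTE r_j]; last first.
  by do 2![apply: big1 => ? _]; rewrite eij r_j andbF mul0r scale0r.
rewrite (bigD1 k') //= [X in _ + X]big1 ?addr0 => [|r /negbTE r_k]; last first.
  by apply: big1 => ? _; rewrite ekl r_k mulr0 scale0r.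
rewrite (bigD1 l') //= [X in _ + X]big1 ?addr0 => [|r /negbTE r_l]; last first.
  by rewrite ekl r_l andbF mulr0 scale0r.
by rewrite eij ekl !eqxx mulr1 scale1r.
Qed.

Definition I1 (i j : nat) : UT -> UT -> UT :=
  product_of (fun a b c d =>
    if [&& a == i.-1, b == i, c == j & d == j.+1] then e 1 n else 0).

(* In I2 and I3 the two conditions are mutually exclusive, since i.+1 != i and
   i.+1 != i.+2, so their order does not matter. *)
Definition I2 (i : nat) : UT -> UT -> UT :=
  product_of (fun a b c d =>
    if [&& a == 1, b == 2, c == i & d == i.+2]%N then e 1 n
    else if [&& a == i, b == i.+1, c == i.+1 & d == i.+2] then e 2 n
    else 0).

Definition I3 (i : nat) : UT -> UT -> UT :=
  product_of (fun a b c d =>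
    if [&& a == i, b == i.+2, c == n.-1 & d == n] then e 1 n
    else if [&& a == i, b == i.+1, c == i.+1 & d == i.+2] then e 1 n.-1
    else 0).

Definition I4 : UT -> UT -> UT :=
  product_of (fun a b c d => if b == c then e a d else 0).

(* The coefficients a i j, b i, c i outside the summation ranges are irrelevant. *)
Definition lincomb123 (a : nat -> nat -> K) (b c : nat -> K) (x y : UT) : UT :=
  \sum_(2 <= i < n.+1) \sum_(1 <= j < n) a i j *: I1 i j x y
  + \sum_(1 <= i < n.-1) b i *: I2 i x y
  + \sum_(1 <= i < n.-1) c i *: I3 i x y.

Definition lincomb1234 (a : nat -> nat -> K) (b c : nat -> K) (d : K)
    (x y : UT) : UT :=
  lincomb123 a b c x y + d *: I4 x y.

End StrictlyUpperTriangular.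

(* Main.v *)
Require Import Defs.
From HB Require Import structures.
From mathcomp Require Import all_boot all_order all_algebra.
From mathcomp Require Import zify.
Import GRing.Theory.
Local Open Scope ring_scope.

Set Implicit Arguments.
Unset Strict Implicit.
Unset Printing Implicit Defensive.

(** Apart from associativity, interchangeability is bilinearity of * together
    with the two mixed identities (a.b)*c = (a*b).c and a.(b*c) = a*(b.c). These
    conditions are linear in *, so the products satisfying them, called
    compatible below, form a vector space, and the theorem says that the listed
    products span it.

    One inclusion is a computation: each listed product is a sum of terms
    (entry of x)(entry of y) times a matrix unit ([I1E], [I2E], [I3E]), or is the
    matrix product itself ([I4E]).

    For the other, the algebra is generated by the superdiagonal units
    e_{i,i+1}, and the mixed identities move a factor out of * into the matrix
    product; hence a compatible product is determined by its values on pairs of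
    superdiagonal units ([compatible_ext]). It remains to see which values are
    possible. If j != k, then e_{ij}.e_{kl} = 0, so the mixed identities make
    every matrix of the algebra annihilate e_{ij} * e_{kl} on both sides, which
    leaves only multiples of e_{1n} ([entry_unlinked]); these are the products
    I^1. For X_i = e_{i,i+1} * e_{i+1,i+2}, multiplying by matrix units gives
    values e_{i,i+2} * e_{km}, to which the previous case applies. Together with
    (u*v).(b.c) = (u.v).(b*c), this leaves only the entries of X_i at (i,i+2),
    (1,n), (2,n) and (1,n-1) ([entry_linked]). The last three are
    matched by I^1, I^2 and I^3, whose values outside the generators are then
    forced. If n > 4, the (i,i+2) entry does not depend on i:
    u.(v*w) and (u*v).w become equal after multiplication by any matrix on either
    side, and when n > 4 there is room for such an extra factor
    ([entry_linked_const]); the common value is the coefficient of I^4. If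
    n <= 4, the position (i,i+2) is always one of the other three, and I^4 is
    already a combination of the products I^1, I^2, I^3. *)

(** * Products compatible with a given product *)

Section Compatible.

Variables (K : fieldType) (A : lmodType K).
Implicit Types f g dot star : A -> A -> A.

(** The conditions of [interchangeable] that are linear in [star]. *)
Definition compatible dot star : Prop :=
  [/\ bilinear_for *:%R *:%R star,
      forall a b c, star (dot a b) c = dot (star a b) c
    & forall a b c, dot a (star b c) = star a (dot b c)].

Lemma interchangeable_compatible dot star :
  interchangeable dot star <-> associative star /\ compatible dot star.
Proof. by split=> [[] | [? []]]. Qed.

Lemma eq_compatible dot f g : f =2 g -> compatible dot g -> compatible dot f.
Proof.
move=> fg [[gl gr] gP gQ]; split=> [|a b c|a b c]; try by rewrite !fg.
by split=> u a x y; rewrite !fg; [apply: gl | apply: gr].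
Qed.

Lemma linear_map0 (h : A -> A) : linear h -> h 0 = 0.
Proof. by move=> hL; have:= hL (-1) 0 0; rewrite scaler0 addr0 scaleN1r addNr. Qed.

Lemma linear_mapD (h : A -> A) x y : linear h -> h (x + y) = h x + h y.
Proof. by move=> hL; have:= hL 1 x y; rewrite !scale1r. Qed.

Lemma linear_mapZ (h : A -> A) a x : linear h -> h (a *: x) = a *: h x.
Proof. by move=> hL; have:= hL a x 0; rewrite (linear_map0 hL) !addr0. Qed.

Lemma bilinear_l f : bilinear_for *:%R *:%R f ->
  forall k a b c, f (k *: a + b) c = k *: f a c + f b c.
Proof. by move=> [fl _] k a b c; apply: fl. Qed.

Lemma bilinear_r f : bilinear_for *:%R *:%R f ->
  forall k a b c, f c (k *: a + b) = k *: f c a + f c b.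
Proof. by move=> [_ fr] k a b c; apply: fr. Qed.

Lemma bilinearD f g : bilinear_for *:%R *:%R f -> bilinear_for *:%R *:%R g ->
  bilinear_for *:%R *:%R (fun x y => f x y + g x y).
Proof.
move=> fB gB; split=> u a x y /=.
  by rewrite (bilinear_l fB) (bilinear_l gB) scalerDr addrACA.
by rewrite (bilinear_r fB) (bilinear_r gB) scalerDr addrACA.
Qed.

Variable dot : A -> A -> A.
Hypothesis dot_bilin : bilinear_for *:%R *:%R dot.

Let dot_l c : linear (dot^~ c). Proof. by case: dot_bilin. Qed.
Let dot_r a : linear (dot a). Proof. by case: dot_bilin. Qed.

Lemma compatible_dot : associative dot -> compatible dot dot.
Proof. by move=> dotA; split. Qed.

Lemma compatible0 : compatible dot (fun _ _ => 0).
Proof.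
split=> [|a b c|a b c]; last by rewrite (linear_map0 (dot_r a)).
  by split=> u a x y /=; rewrite scaler0 addr0.
by rewrite (linear_map0 (dot_l c)).
Qed.

Lemma compatibleD f g : compatible dot f -> compatible dot g ->
  compatible dot (fun x y => f x y + g x y).
Proof.
move=> [fB fP fQ] [gB gP gQ]; split=> [|a b c|a b c].
- exact: bilinearD.
- by rewrite (linear_mapD _ _ (dot_l c)) fP gP.
- by rewrite (linear_mapD _ _ (dot_r a)) fQ gQ.
Qed.

Lemma compatibleZ k f : compatible dot f -> compatible dot (fun x y => k *: f x y).
Proof.
move=> [fB fP fQ]; split=> [|a b c|a b c].
- by split=> u a x y /=;
     rewrite ?(bilinear_l fB) ?(bilinear_r fB) scalerDr !scalerA mulrC.
- by rewrite (linear_mapZ _ _ (dot_l c)) fP.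
- by rewrite (linear_mapZ _ _ (dot_r a)) fQ.
Qed.

Lemma compatible_sum (I : eqType) (r : seq I) (F : I -> A -> A -> A) :
    (forall i, i \in r -> compatible dot (F i)) ->
  compatible dot (fun x y => \sum_(i <- r) F i x y).
Proof.
elim: r => [|i r IHr] compF.
  by apply: (eq_compatible _ compatible0) => x y; rewrite big_nil.
have FiP: compatible dot (F i) by apply/compF/mem_head.
have FrP: compatible dot (fun x y => \sum_(j <- r) F j x y).
  by apply: IHr => j jr; apply: compF; rewrite inE jr orbT.
by apply: (eq_compatible _ (compatibleD FiP FrP)) => x y; rewrite big_cons.
Qed.

End Compatible.

(** * Entries of strictly upper triangular matrices *)

Section Entries.

Variables (K : fieldType) (n : nat).
Implicit Types x y : UT K n.

Let row_unit i : 'rV[K]_n := \row_r (r.+1 == i)%:R.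
Let col_unit j : 'cV[K]_n := \col_s (s.+1 == j)%:R.

Lemma UT_val_eq0 x (i j : 'I_n) : (j <= i)%N -> UT_val x i j = 0.
Proof. by case: x => x xU; move/strict_upperP: (xU); apply. Qed.

Lemma UT_mulE x y : UT_val (UT_mul x y) = UT_val x *m UT_val y.
Proof. by []. Qed.

(** The (i, j) entry numbered from 1, over natural numbers so that indices can
    be compared by linear arithmetic. Writing it as row unit, matrix, column unit
    makes products with e_{ij} (a column unit times a row unit) collapse by
    associativity. *)
Definition entry x i j : K := (row_unit i *m UT_val x *m col_unit j) 0 0.

Lemma row_col_unit i j : (i == j -> 0 < i <= n)%N ->
  row_unit i *m col_unit j = (i == j)%:R%:M.
Proof.
move=> i_in; apply/matrixP=> r s; rewrite !mxE !ord1 eqxx mulr1n.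
have [eq_ij|neq_ij] := eqVneq i j; last first.
  rewrite big1 // => k _; rewrite !mxE.
  by case: eqP => [->|_]; rewrite ?(negbTE neq_ij) ?mulr0 ?mul0r.
have {i_in} := i_in (introT eqP eq_ij); rewrite -eq_ij {j eq_ij}.
case: i => // i /= lt_in.
rewrite (bigD1 (Ordinal lt_in)) //= big1 => [|k neq_ki].
  by rewrite !mxE eqxx mul1r addr0.
by rewrite !mxE eqSS (negbTE neq_ki : (val k == i) = false) mul0r.
Qed.

Lemma e_unit i j : (0 < i < j)%N -> UT_val (e K n i j) = col_unit i *m row_unit j.
Proof.
case/andP=> i_gt0 lt_ij; apply/matrixP=> r s; rewrite eE // !mxE big_ord1 !mxE.
by case: eqP; case: eqP; rewrite ?mulr0 ?mul0r ?mulr1.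
Qed.

Lemma entry_ord x (r s : 'I_n) : entry x r.+1 s.+1 = UT_val x r s.
Proof.
rewrite /entry mxE (bigD1 s) //= big1 => [|k /negbTE neq_ks]; last first.
  by rewrite [X in _ * X]mxE eqSS (neq_ks : (val k == s) = false) mulr0.
rewrite [X in _ * X]mxE eqxx mulr1 addr0 mxE (bigD1 r) //= big1 => [|k /negbTE neq_kr].
  by rewrite mxE eqxx mul1r addr0.
by rewrite mxE eqSS (neq_kr : (val k == r) = false) mul0r.
Qed.

Lemma entryD x y i j : entry (x + y) i j = entry x i j + entry y i j.
Proof. by rewrite /entry /= mulmxDr mulmxDl mxE. Qed.

Lemma entryZ a x i j : entry (a *: x) i j = a * entry x i j.
Proof. by rewrite /entry /= -scalemxAr -scalemxAl mxE. Qed.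

Lemma entry0 i j : entry 0 i j = 0.
Proof. by rewrite -(scale0r 0) entryZ mul0r. Qed.

Lemma entry_ext x y :
  (forall i j, (0 < i)%N -> (i < j <= n)%N -> entry x i j = entry y i j) -> x = y.
Proof.
move=> eq_xy; apply/val_inj/matrixP=> r s; have [le_sr|lt_rs] := leqP s r.
  by rewrite !UT_val_eq0.
by rewrite -!entry_ord eq_xy // ltnS lt_rs ltn_ord.
Qed.

Lemma entry_e_mul i j x r s : (0 < i < j)%N -> (j <= n)%N ->
  entry (UT_mul (e K n i j) x) r s = (r == i)%:R * entry x j s.
Proof.
move=> ij le_jn; rewrite /entry UT_mulE e_unit // 2!mulmxA row_col_unit; last by lia.
by rewrite mul_scalar_mx -!scalemxAl mxE.
Qed.

Lemma entry_mul_e i j x r s : (0 < i < j)%N -> (j <= n)%N ->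
  entry (UT_mul x (e K n i j)) r s = (s == j)%:R * entry x r i.
Proof.
move=> ij le_jn; rewrite /entry UT_mulE e_unit // !mulmxA -(mulmxA _ (row_unit j)).
rewrite row_col_unit; last by lia.
by rewrite mul_mx_scalar mxE eq_sym.
Qed.

Lemma entry_e i j r s : (0 < i < j)%N -> (j <= n)%N ->
  entry (e K n i j) r s = ((r == i) && (s == j))%:R.
Proof.
move=> ij le_jn; rewrite /entry e_unit // mulmxA -mulmxA !row_col_unit; [|lia..].
by rewrite mul_scalar_mx mxE mxE eqxx mulr1n (eq_sym j) -natrM mulnb.
Qed.

Lemma e_mul_e i j k : (0 < i < j)%N -> (j < k <= n)%N ->
  UT_mul (e K n i j) (e K n j k) = e K n i k.
Proof.
move=> ij jk; apply: entry_ext => r s r_gt0 rs.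
rewrite entry_e_mul ?entry_e; [|lia..].
by rewrite eqxx -natrM mulnb.
Qed.

Lemma e_mul_e0 i j k l : (0 < i < j)%N -> (j <= n)%N -> (0 < k < l)%N -> (l <= n)%N ->
  j != k -> UT_mul (e K n i j) (e K n k l) = 0.
Proof.
move=> ij le_jn kl le_ln neq_jk; apply: entry_ext => r s r_gt0 rs.
by rewrite entry_e_mul // entry_e // (negbTE neq_jk) mulr0 entry0.
Qed.

Lemma sum_e x : x = \sum_(i < n) \sum_(j < n) UT_val x i j *: e K n i.+1 j.+1.
Proof.
apply: val_inj; rewrite [LHS]matrix_sum_delta linear_sum; apply: eq_bigr => i _.
rewrite linear_sum; apply: eq_bigr => j _; rewrite linearZ /=.
have [le_ji|lt_ij] := leqP j i.
  by rewrite UT_val_eq0 // !scale0r.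
by congr (_ *: _); apply/matrixP=> r s; rewrite eE // mxE !eqSS.
Qed.

Lemma linear_ext (g h : UT K n -> UT K n) : linear g -> linear h ->
  (forall i j, (0 < i < j)%N -> (j <= n)%N -> g (e K n i j) = h (e K n i j)) -> g =1 h.
Proof.
move=> gL hL eq_gh.
pose gLm : {linear UT K n -> UT K n} := HB.pack g (GRing.isLinear.Build K _ _ _ g gL).
pose hLm : {linear UT K n -> UT K n} := HB.pack h (GRing.isLinear.Build K _ _ _ h hL).
move=> x; rewrite (sum_e x) -[g]/(gLm : _ -> _) -[h]/(hLm : _ -> _) !linear_sum.
apply: eq_bigr => i _; rewrite !linear_sum; apply: eq_bigr => j _; rewrite !linearZ /=.
have [le_ji|lt_ij] := leqP j i; last by rewrite eq_gh.
by rewrite UT_val_eq0 // !scale0r.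
Qed.

Lemma bilinear_ext (f g : UT K n -> UT K n -> UT K n) :
    bilinear_for *:%R *:%R f -> bilinear_for *:%R *:%R g ->
    (forall i j k l, (0 < i < j)%N -> (j <= n)%N -> (0 < k < l)%N -> (l <= n)%N ->
      f (e K n i j) (e K n k l) = g (e K n i j) (e K n k l)) ->
  f =2 g.
Proof.
move=> [fl fr] [gl gr] eq_fg x y.
apply: (linear_ext (fl y) (gl y)) => i j ij le_jn.
by apply: (linear_ext (fr _) (gr _)) => k l kl le_ln; apply: eq_fg.
Qed.

Lemma entry_eq0 x i j : (0 < j <= i)%N -> (i <= n)%N -> entry x i j = 0.
Proof.
case: i j => [|i] [|j] // le_ji lt_in; have lt_jn : (j < n)%N by lia.
by rewrite (entry_ord x (Ordinal lt_in) (Ordinal lt_jn)) UT_val_eq0.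
Qed.

(** A product of two strictly upper triangular matrices vanishes on the
    superdiagonal, and on the next diagonal it only sees the superdiagonals of
    its factors. As e_{1n} is annihilated on both sides, the only mixed identities
    for I^1, I^2 and I^3 in which both sides can be nonzero are the second one for
    I^2 and the first one for I^3; the former matches [mul_e2n], and the latter
    [e1pred_mul], with [entry_mul_superdiag2]. *)
Lemma entry_mul_superdiag x y i : (0 < i < n)%N -> entry (UT_mul x y) i i.+1 = 0.
Proof.
case: i => // i /= lt_in; have lt_i'n : (i < n)%N by lia.
rewrite (entry_ord _ (Ordinal lt_i'n) (Ordinal lt_in)) mxE big1 // => k _.
have [le_ki|lt_ik] := leqP k i; first by rewrite UT_val_eq0 ?mul0r.
by rewrite [X in _ * X]UT_val_eq0 ?mulr0.
Qed.

Lemma entry_mul_superdiag2 x y i : (0 < i)%N -> (i.+1 < n)%N ->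
  entry (UT_mul x y) i i.+2 = entry x i i.+1 * entry y i.+1 i.+2.
Proof.
case: i => // i _ lt2; have lt1 : (i.+1 < n)%N by lia.
have lt0 : (i < n)%N by lia.
rewrite (entry_ord _ (Ordinal lt0) (Ordinal lt2)).
rewrite (entry_ord x (Ordinal lt0) (Ordinal lt1)) (entry_ord y (Ordinal lt1) (Ordinal lt2)) mxE.
rewrite (bigD1 (Ordinal lt1)) //= big1 ?addr0 // => k.
rewrite -val_eqE /= => neq_k.
have [le_ki|lt_ik] := leqP k i; first by rewrite UT_val_eq0 ?mul0r.
by rewrite [X in _ * X]UT_val_eq0 ?mulr0 //=; lia.
Qed.

Lemma linear_UT_mul_l y : linear (@UT_mul K n ^~ y).
Proof. by case: (UT_mul_bilinear K n). Qed.

Lemma linear_UT_mul_r x : linear (@UT_mul K n x).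
Proof. by case: (UT_mul_bilinear K n). Qed.

Lemma e_last_mul i x : (0 < i < n)%N -> UT_mul (e K n i n) x = 0.
Proof.
move=> i_in; apply: entry_ext => r s r_gt0 rs.
by rewrite entry_e_mul // entry0 (entry_eq0 x) ?mulr0 //; lia.
Qed.

Lemma mul_e_first j x : (1 < j <= n)%N -> UT_mul x (e K n 1 j) = 0.
Proof.
move=> j_in; apply: entry_ext => r s r_gt0 rs.
by rewrite entry_mul_e ?entry0 ?(entry_eq0 x) ?mulr0 //; lia.
Qed.

Lemma mul_e2n x : (2 < n)%N -> UT_mul x (e K n 2 n) = entry x 1 2 *: e K n 1 n.
Proof.
move=> n_gt2; apply: entry_ext => r s r_gt0 rs.
rewrite entry_mul_e ?entryZ ?entry_e; [|lia..].
have [->|neq_r1] := eqVneq r 1%N; first by rewrite mulrC.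
by rewrite (entry_eq0 x) ?mulr0 //; lia.
Qed.

Lemma e1pred_mul x : (2 < n)%N ->
  UT_mul (e K n 1 n.-1) x = entry x n.-1 n *: e K n 1 n.
Proof.
move=> n_gt2; apply: entry_ext => r s r_gt0 rs.
rewrite entry_e_mul ?entryZ ?entry_e; [|lia..].
have [->|neq_sn] := eqVneq s n; first by rewrite andbT mulrC.
by rewrite andbF (entry_eq0 x) ?mulr0 //; lia.
Qed.

(** * The listed products are compatible *)

Section ClosedForms.

Lemma product_of_bilinear t : bilinear_for *:%R *:%R (@product_of K n t).
Proof.
split=> u a x y; rewrite /product_of /=;
  do 4![rewrite scaler_sumr -big_split /=; apply: eq_bigr => ? _];
  by rewrite !mxE ?mulrDl ?mulrDr scalerDl scalerA ?mulrA // (mulrC a).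
Qed.

Definition rank_one p q r s (v : UT K n) x y := (entry x p q * entry y r s) *: v.

Lemma rank_one_bilinear p q r s v : bilinear_for *:%R *:%R (rank_one p q r s v).
Proof.
split=> u a x y; rewrite /rank_one /= entryD entryZ ?mulrDl ?mulrDr scalerDl scalerA.
  by rewrite mulrA.
by rewrite !mulrA (mulrC a).
Qed.

Lemma rank_one_e p q r s v i j k l :
    (0 < i < j)%N -> (j <= n)%N -> (0 < k < l)%N -> (l <= n)%N ->
  rank_one p q r s v (e K n i j) (e K n k l) =
    if [&& i == p, j == q, k == r & l == s] then v else 0.
Proof.
move=> ij le_jn kl le_ln; rewrite /rank_one !entry_e // -natrM mulnb.
rewrite !(eq_sym i) !(eq_sym j) !(eq_sym k) !(eq_sym l) -andbA.
by case: ifP; rewrite ?scale1r ?scale0r.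
Qed.

Lemma I1E i j : I1 i j =2 rank_one i.-1 i j j.+1 (e K n 1 n).
Proof.
apply: bilinear_ext; [exact: product_of_bilinear|exact: rank_one_bilinear|].
move=> p q r s pq le_qn rs le_sn.
by rewrite rank_one_e // /I1 product_ofE //; lia.
Qed.

Lemma I2E i : I2 i =2 fun x y => rank_one 1 2 i i.+2 (e K n 1 n) x y
                               + rank_one i i.+1 i.+1 i.+2 (e K n 2 n) x y.
Proof.
apply: bilinear_ext; first exact: product_of_bilinear.
  by apply: bilinearD; apply: rank_one_bilinear.
move=> p q r s pq le_qn rs le_sn; rewrite !rank_one_e // /I2 product_ofE; [|lia..].
case: ifP => [C1|_]; last by rewrite add0r.
by rewrite ifF ?addr0 //; lia.
Qed.

Lemma I3E i : I3 i =2 fun x y => rank_one i i.+2 n.-1 n (e K n 1 n) x y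
                               + rank_one i i.+1 i.+1 i.+2 (e K n 1 n.-1) x y.
Proof.
apply: bilinear_ext; first exact: product_of_bilinear.
  by apply: bilinearD; apply: rank_one_bilinear.
move=> p q r s pq le_qn rs le_sn; rewrite !rank_one_e // /I3 product_ofE; [|lia..].
case: ifP => [C1|_]; last by rewrite add0r.
by rewrite ifF ?addr0 //; lia.
Qed.

Lemma I4E : @I4 K n =2 @UT_mul K n.
Proof.
apply: bilinear_ext; [exact: product_of_bilinear|exact: UT_mul_bilinear|].
move=> p q r s pq le_qn rs le_sn; rewrite /I4 product_ofE; [|lia..].
have [eq_qr|neq_qr] := eqVneq q r; last by rewrite e_mul_e0.
by rewrite -eq_qr in rs *; rewrite e_mul_e //; lia.
Qed.

Hypothesis n_ge3 : (3 <= n)%N.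

Lemma I1_compatible i j : (1 < i <= n)%N -> (1 <= j < n)%N ->
  compatible (@UT_mul K n) (I1 i j).
Proof.
case: i => // i i_in j_in; apply: (eq_compatible (I1E _ _)).
split=> [|a b c|a b c]; first exact: rank_one_bilinear.
  rewrite /rank_one (linear_mapZ _ _ (linear_UT_mul_l c)) e_last_mul; last by lia.
  by rewrite entry_mul_superdiag ?mul0r ?scale0r ?scaler0 //; lia.
rewrite /rank_one linear_mapZ; last exact: linear_UT_mul_r.
by rewrite mul_e_first ?entry_mul_superdiag ?mulr0 ?scale0r ?scaler0 //; lia.
Qed.

Lemma I2_compatible i : (1 <= i < n.-1)%N -> compatible (@UT_mul K n) (I2 i).
Proof.
move=> i_in; apply: (eq_compatible (I2E _)).
split=> [|a b c|a b c]; first by apply: bilinearD; apply: rank_one_bilinear.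
  rewrite (linear_mapD _ _ (linear_UT_mul_l c)) /rank_one.
  rewrite !(linear_mapZ _ _ (linear_UT_mul_l c)) !e_last_mul; [|lia..].
  by rewrite !entry_mul_superdiag ?mul0r ?scale0r ?scaler0 //; lia.
rewrite /rank_one (linear_mapD _ _ (linear_UT_mul_r a)).
rewrite !(linear_mapZ _ _ (linear_UT_mul_r a)) mul_e_first ?mul_e2n; [|lia..].
rewrite entry_mul_superdiag ?entry_mul_superdiag2; [|lia..].
by rewrite scaler0 mulr0 scale0r add0r addr0 scalerA mulrC.
Qed.

Lemma I3_compatible i : (1 <= i < n.-1)%N -> compatible (@UT_mul K n) (I3 i).
Proof.
move=> i_in; apply: (eq_compatible (I3E _)).
split=> [|a b c|a b c]; first by apply: bilinearD; apply: rank_one_bilinear.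
  rewrite (linear_mapD _ _ (linear_UT_mul_l c)) /rank_one.
  rewrite !(linear_mapZ _ _ (linear_UT_mul_l c)) e_last_mul ?e1pred_mul; [|lia..].
  rewrite entry_mul_superdiag ?entry_mul_superdiag2; [|lia..].
  by rewrite scaler0 mul0r scale0r add0r addr0 scalerA.
rewrite /rank_one (linear_mapD _ _ (linear_UT_mul_r a)).
rewrite !(linear_mapZ _ _ (linear_UT_mul_r a)) !mul_e_first; [|lia..].
have last0 : entry (UT_mul b c) n.-1 n = 0.
  by rewrite -[X in entry _ _ X](@prednK n) ?entry_mul_superdiag //; lia.
rewrite last0 entry_mul_superdiag; last by lia.
by rewrite !mulr0 !scale0r !scaler0.
Qed.

Lemma I4_compatible : compatible (@UT_mul K n) (@I4 K n).
Proof.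
apply: (eq_compatible I4E).
exact: compatible_dot (UT_mul_bilinear K n) (@UT_mulA K n).
Qed.

Lemma lincomb1234_compatible a b c d :
  compatible (@UT_mul K n) (@lincomb1234 K n a b c d).
Proof.
have bilin := UT_mul_bilinear K n.
apply: compatibleD => //; last by apply: compatibleZ => //; apply: I4_compatible.
apply: compatibleD => //; first apply: compatibleD => //.
- apply: compatible_sum => // i; rewrite mem_index_iota => i_in.
  apply: compatible_sum => // j; rewrite mem_index_iota => j_in.
  by apply: compatibleZ => //; apply: I1_compatible.
- apply: compatible_sum => // i; rewrite mem_index_iota => i_in.
  by apply: compatibleZ => //; apply: I2_compatible.
- apply: compatible_sum => // i; rewrite mem_index_iota => i_in.
  by apply: compatibleZ => //; apply: I3_compatible.
Qed.

Lemma lincomb123_1234 a b c : @lincomb123 K n a b c =2 lincomb1234 a b c 0.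
Proof. by move=> x y; rewrite /lincomb1234 scale0r addr0. Qed.

End ClosedForms.

(** * Values of a compatible product on the generators *)

Section Generators.

Variable f : UT K n -> UT K n -> UT K n.
Hypothesis fC : compatible (@UT_mul K n) f.

Local Notation E := (e K n).

Let fP a b c : f (UT_mul a b) c = UT_mul (f a b) c. Proof. by case: fC. Qed.
Let fQ a b c : UT_mul a (f b c) = f a (UT_mul b c). Proof. by case: fC. Qed.
Let f0r a : f a 0 = 0.
Proof. by case: fC => -[_ fr] _ _; apply: linear_map0 (fr a). Qed.
Let f0l a : f 0 a = 0.
Proof. by case: fC => -[fl _] _ _; apply: linear_map0 (fl a). Qed.

(** Since e_{ij}.e_{kl} = 0, every matrix annihilates e_{ij} * e_{kl} on both
    sides; multiplying by e_{1r} or e_{sn} isolates any row r > 1 and any column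
    s < n. *)
Lemma entry_unlinked i j k l r s :
    (0 < i < j)%N -> (j <= n)%N -> (0 < k < l)%N -> (l <= n)%N -> j != k ->
    (0 < r < s)%N -> (s <= n)%N -> ~~ ((r == 1) && (s == n))%N ->
  entry (f (E i j) (E k l)) r s = 0.
Proof.
move=> ij le_jn kl le_ln neq_jk rs le_sn; rewrite negb_and => /orP[neq_r1|neq_sn].
  have := fQ (E 1 r) (E i j) (E k l); rewrite (e_mul_e0 ij) //.
  rewrite f0r => /(congr1 (fun x => entry x 1 s)).
  by rewrite entry_e_mul ?entry0 ?mul1r //; lia.
have := fP (E i j) (E k l) (E s n); rewrite (e_mul_e0 ij) //.
rewrite f0l => /(congr1 (fun x => entry x r n)) /esym.
by rewrite entry_mul_e ?eqxx ?entry0 ?mul1r //; lia.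
Qed.

(** The middle index j disappears, so that the multiples of e_{ij} * e_{jl} can be
    read off from values of * at e_{il}. *)
Lemma linked_mul i j l c : (0 < i < j)%N -> (j < l <= n)%N ->
  UT_mul (f (E i j) (E j l)) c = f (E i l) c.
Proof. by move=> ij jl; rewrite -fP e_mul_e. Qed.

Lemma mul_linked i j l c : (0 < i < j)%N -> (j < l <= n)%N ->
  UT_mul c (f (E i j) (E j l)) = f c (E i l).
Proof. by move=> ij jl; rewrite fQ e_mul_e. Qed.

(** Both sides equal (u.v)*(b.c). *)
Lemma mul_mul_exchange u v b c :
  UT_mul (f u v) (UT_mul b c) = UT_mul (UT_mul u v) (f b c).
Proof. by rewrite -fP fQ. Qed.

(** Here u.(v*w) = u*(v.w) and (u*v).w = (u.v)*w need not be equal, but after one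
    more multiplication on the right both give (u.v.w)*c; on the left, in
    [mul_exchange_r], both give c*(u.v.w). *)
Lemma mul_exchange_l u v w c :
  UT_mul (UT_mul u (f v w)) c = UT_mul (UT_mul (f u v) w) c.
Proof. by rewrite fQ -fP UT_mulA -(fP u v w) -fP. Qed.

Lemma mul_exchange_r u v w c :
  UT_mul c (UT_mul u (f v w)) = UT_mul c (UT_mul (f u v) w).
Proof. by rewrite -(fP u v w) !fQ UT_mulA. Qed.

(** Most entries of X = e_{i,i+1} * e_{i+1,i+2} appear, after multiplication by a
    matrix unit, in a value of * to which [entry_unlinked] applies. This fails for
    column i+2 under right multiplication and for row i under left
    multiplication, where the factor is linked to e_{i,i+2}. The two positions
    that remain, (i,n) and (1,i+2), are settled by [mul_mul_exchange], one side of
    which is supported on a single column or row. *)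
Lemma entry_linked i r s : (0 < i)%N -> (i.+2 <= n)%N -> (0 < r < s)%N -> (s <= n)%N ->
    ~~ [|| (r == i) && (s == i.+2), (r == 1) && (s == n),
           (r == 2) && (s == n) | (r == 1) && (s == n.-1)]%N ->
  entry (f (E i i.+1) (E i.+1 i.+2)) r s = 0.
Proof.
move=> i_gt0 le_in rs le_sn rs_out; set X := f _ _.
(* Reading X at column k through X.e_{km}, and below at row m through e_{km}.X. *)
have Xr k m : (0 < k < m)%N -> (m <= n)%N ->
    entry X r k = entry (f (E i i.+2) (E k m)) r m.
  by move=> km le_mn; rewrite -(@linked_mul i i.+1)
     ?(entry_mul_e _ _ _ km) ?eqxx ?mul1r //; lia.
have Xl k m : (0 < k < m)%N -> (m <= n)%N ->
    entry X m s = entry (f (E k m) (E i i.+2)) k s.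
  by move=> km le_mn; rewrite -(@mul_linked i i.+1)
     ?(entry_e_mul _ _ _ km) ?eqxx ?mul1r //; lia.
have [lt_sn|ge_sn] := ltnP s n; last first.
  have eq_sn : s = n by lia.
  have [eq_ri|neq_ri] := eqVneq r i; last first.
    by rewrite (Xl 2) ?entry_unlinked //; lia.
  (* e_{1i}.X has the form y.e_{i,i+2}, so it lives in column i+2. *)
  have /(congr1 (fun x => entry x 1 n)) :=
    mul_mul_exchange (E 1 2) (E 2 i) (E i i.+1) (E i.+1 i.+2).
  rewrite !e_mul_e; [|lia..].
  rewrite entry_e_mul ?entry_mul_e; [|lia..].
  rewrite -/X eqxx mul1r eq_ri eq_sn => <-.
  by rewrite (_ : _ == _ = false) ?mul0r //; lia.
have [eq_s|neq_s] := eqVneq s i.+2; last first.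
  have [eq_r1|neq_r1] := eqVneq r 1%N.
    by rewrite (Xr _ n.-1) ?entry_unlinked //; lia.
  by rewrite (Xr _ n) ?entry_unlinked //; lia.
have [eq_r1|neq_r1] := eqVneq r 1%N; last first.
  by rewrite (Xl 1%N) ?entry_unlinked //; lia.
(* X.e_{sn} has the form e_{i,i+2}.y, so it lives in row i. *)
have /(congr1 (fun x => entry x 1 n)) :=
  mul_mul_exchange (E i i.+1) (E i.+1 i.+2) (E s n.-1) (E n.-1 n).
rewrite !e_mul_e; [|lia..].
rewrite entry_e_mul ?entry_mul_e; [|lia..].
rewrite -/X eqxx mul1r eq_r1 => ->.
by rewrite (_ : _ == _ = false) ?mul0r //; lia.
Qed.

(** For u, v, w three consecutive superdiagonal units, u.(v*w) and (u*v).w carry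
    two consecutive values of the entry at the same position (i, i+3). An extra
    factor e_{i+3,n} or e_{1,i} is available unless i = 1 and i + 3 = n. *)
Lemma entry_linked_const i : (4 < n)%N -> (0 < i)%N -> (i.+2 <= n)%N ->
  entry (f (E i i.+1) (E i.+1 i.+2)) i i.+2 = entry (f (E 1 2) (E 2 3)) 1 3.
Proof.
move=> n_gt4; case: i => // i _; elim: i => // i IHi le_in.
rewrite -IHi; last by lia.
have [lt_in|ge_in] := ltnP i.+4 n.
  have /(congr1 (fun x => entry x i.+1 n)) :=
    mul_exchange_l (E i.+1 i.+2) (E i.+2 i.+3) (E i.+3 i.+4) (E i.+4 n).
  rewrite !entry_mul_e ?eqxx ?mul1r; [|lia..].
  by rewrite entry_e_mul ?eqxx ?mul1r //; lia.
have /(congr1 (fun x => entry x 1 i.+4)) :=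
  mul_exchange_r (E i.+1 i.+2) (E i.+2 i.+3) (E i.+3 i.+4) (E 1 i.+1).
rewrite !entry_e_mul ?eqxx ?mul1r; [|lia..].
by rewrite entry_mul_e ?eqxx ?mul1r //; lia.
Qed.

End Generators.

(** Every e_{kl} is a product of superdiagonal units, and the mixed identities
    pull all but one unit of each argument out of the product. *)
Lemma compatible_ext f g :
    compatible (@UT_mul K n) f -> compatible (@UT_mul K n) g ->
    (forall i k, (0 < i < n)%N -> (0 < k < n)%N ->
      f (e K n i i.+1) (e K n k k.+1) = g (e K n i i.+1) (e K n k k.+1)) ->
  f =2 g.
Proof.
move=> [fB fP fQ] [gB gP gQ] eq_fg.
have eq_fg_r m : forall i k, (0 < i < n)%N -> (0 < k)%N -> (k + m.+1 <= n)%N ->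
    f (e K n i i.+1) (e K n k (k + m.+1)) = g (e K n i i.+1) (e K n k (k + m.+1)).
  elim: m => [|m IHm] i k i_in k_gt0 le_kn; first by rewrite addn1 eq_fg //; lia.
  rewrite -(e_mul_e (i := k) (j := k.+1)); [|lia..].
  by rewrite -fQ -gQ addnS -addSn IHm //; lia.
have {}eq_fg_r i k l : (0 < i < n)%N -> (0 < k < l)%N -> (l <= n)%N ->
    f (e K n i i.+1) (e K n k l) = g (e K n i i.+1) (e K n k l).
  move=> i_in kl le_ln; have := @eq_fg_r (l - k.+1)%N i k.
  by rewrite -addSnnS subnKC; [apply; lia|lia].
apply: bilinear_ext => // i j k l ij le_jn kl le_ln.
have [->|neq_ji] := eqVneq j i.+1; first by apply: eq_fg_r => //; lia.
rewrite -(e_mul_e (i := i) (j := i.+1)); [|lia..].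
by rewrite fP gP eq_fg_r //; lia.
Qed.

Lemma big_nat_only (V : nmodType) m p q (F : nat -> V) : (m <= p < q)%N ->
    (forall i, (m <= i < q)%N -> i != p -> F i = 0) ->
  \sum_(m <= i < q) F i = F p.
Proof.
move=> p_in F0; rewrite (bigD1_seq p) ?iota_uniq ?mem_index_iota //=.
by rewrite big1_seq ?addr0 // => i; rewrite mem_index_iota => /andP[neq_ip /F0->].
Qed.

Lemma lincomb1234_superdiag a b c d p q :
    (3 <= n)%N -> (0 < p < n)%N -> (0 < q < n)%N ->
  lincomb1234 a b c d (e K n p p.+1) (e K n q q.+1) =
  a p.+1 q *: e K n 1 n
  + (if q == p.+1 then b p *: e K n 2 n + c p *: e K n 1 n.-1 + d *: e K n p p.+2
     else 0).
Proof.
move=> n_ge3 p_in q_in; rewrite /lincomb1234 /lincomb123.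
have I1_val i j : I1 i j (e K n p p.+1) (e K n q q.+1) =
    if (i == p.+1) && (j == q) then e K n 1 n else 0.
  by rewrite /I1 product_ofE; [congr (if _ then _ else _)|..]; lia.
have I2_val i : I2 i (e K n p p.+1) (e K n q q.+1) =
    if (i == p) && (q == p.+1) then e K n 2 n else 0.
  rewrite /I2 product_ofE; [|lia..]; rewrite ifF; last by lia.
  by congr (if _ then _ else _); lia.
have I3_val i : I3 i (e K n p p.+1) (e K n q q.+1) =
    if (i == p) && (q == p.+1) then e K n 1 n.-1 else 0.
  rewrite /I3 product_ofE; [|lia..]; rewrite ifF; last by lia.
  by congr (if _ then _ else _); lia.
rewrite (big_nat_only (p := p.+1)); [|lia|]; last first.
  move=> i _ neq_i; apply: big1_seq => j _.
  by rewrite I1_val (negbTE neq_i) scaler0.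
rewrite (big_nat_only (p := q)) => [||j _ neq_j]; [|lia|]; last first.
  by rewrite I1_val (negbTE neq_j) andbF scaler0.
rewrite I1_val !eqxx I4E -!addrA; congr (_ + _).
have [eq_q|neq_q] := eqVneq q p.+1; last first.
  rewrite e_mul_e0 ?scaler0; try lia.
  by rewrite !big1_seq ?addr0 // => i _;
     rewrite ?I2_val ?I3_val (negbTE neq_q) andbF scaler0.
rewrite eq_q in I2_val I3_val *; rewrite e_mul_e; [|lia..].
rewrite (big_nat_only (p := p)); [|lia|]; last first.
  by move=> i _ neq_i; rewrite I2_val (negbTE neq_i) scaler0.
rewrite (big_nat_only (p := p)); [|lia|]; last first.
  by move=> i _ neq_i; rewrite I3_val (negbTE neq_i) scaler0.
by rewrite I2_val I3_val !eqxx addrA.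
Qed.

(** The coefficient of I^4 is an argument because it is not determined when
    n <= 4: there I^4 is redundant, and the value 0 is chosen. *)
Lemma compatible_lincomb f d : (3 <= n)%N -> compatible (@UT_mul K n) f ->
    ((n <= 4)%N -> d = 0) ->
    ((4 < n)%N -> d = entry (f (e K n 1 2) (e K n 2 3)) 1 3) ->
  exists a b c, f =2 lincomb1234 a b c d.
Proof.
move=> n_ge3 fC d_small d_large; pose X i k := f (e K n i i.+1) (e K n k k.+1).
exists (fun i j => entry (X i.-1 j) 1 n), (fun i => entry (X i i.+1) 2 n),
  (fun i => entry (X i i.+1) 1 n.-1).
apply: compatible_ext => // [|i k i_in k_in]; first exact: lincomb1234_compatible.
rewrite lincomb1234_superdiag // -/(X i k) /=; apply: entry_ext => r s r_gt0 rs.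
have [eq_k|neq_k] := eqVneq k i.+1; last first.
  rewrite addr0 entryZ entry_e; [|lia..].
  have [/andP[/eqP-> /eqP->]|rs_out] := boolP ((r == 1) && (s == n))%N.
    by rewrite mulr1.
  by rewrite mulr0 (entry_unlinked fC) //; lia.
rewrite eq_k /= in k_in *; rewrite !entryD !entryZ !entry_e; [|lia..].
(* For n <= 4 each position (i,i+2) is one of (1,n), (2,n), (1,n-1), whereas for
   n > 4 it is none of them. *)
have d_corner : d * ((r == i) && (s == i.+2))%:R =
    if [&& (r == i) && (s == i.+2), ~~ ((r == 1) && (s == n)),
           ~~ ((r == 2) && (s == n)) & ~~ ((r == 1) && (s == n.-1))]%N
    then entry (X i i.+1) r s else 0.
  have [n_gt4|n_le4] := ltnP 4 n; last by rewrite d_small // mul0r ifF //; lia.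
  case: (boolP (_ && _)) => [/andP[/eqP-> /eqP->]|_]; last by rewrite mulr0.
  by rewrite ifT ?mulr1 ?d_large -?(entry_linked_const fC n_gt4 (i := i)) //; lia.
have neq_n : (n == n.-1) = false by lia.
rewrite {}d_corner.
have [/andP[/eqP-> /eqP->]|out_1n] := boolP ((r == 1) && (s == n))%N.
  by rewrite /= neq_n !andbF /= mulr1 !mulr0 !addr0.
have [/andP[/eqP-> /eqP->]|out_2n] := boolP ((r == 2) && (s == n))%N.
  by rewrite /= !andbF mulr1 !mulr0 !addr0 add0r.
have [/andP[/eqP-> /eqP->]|out_1n1] := boolP ((r == 1) && (s == n.-1))%N.
  by rewrite /= !andbF mulr1 !mulr0 addr0 !add0r.
rewrite !mulr0 !add0r !andbT.
by case: ifP => // /negbT out_i; rewrite (entry_linked fC) //; lia.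
Qed.

End Entries.

(** * The classification *)

Theorem theorem4p19 (K : fieldType) (n : nat) (n_ge3 : (3 <= n)%N) :
  ((4 < n)%N ->
    forall star : UT K n -> UT K n -> UT K n,
      interchangeable (@UT_mul K n) star <->
      associative star /\
      exists (a : nat -> nat -> K) (b c : nat -> K) (d : K),
        star =2 lincomb1234 a b c d)
  /\
  (n = 3%N \/ n = 4%N ->
    forall star : UT K n -> UT K n -> UT K n,
      interchangeable (@UT_mul K n) star <->
      associative star /\
      exists (a : nat -> nat -> K) (b c : nat -> K),
        star =2 lincomb123 a b c).
Proof.
split=> [n_gt4|n34] star.
  apply: iff_trans (interchangeable_compatible _ _) _.
  split=> -[starA starP]; split=> //.
    have [|a [b [c eq_star]]] := compatible_lincomb n_ge3 starP _ (fun=> erefl).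
      by lia.
    by exists a, b, c; eexists; apply: eq_star.
  case: starP => a [b [c [d eq_star]]].
  by apply: eq_compatible eq_star _; apply: lincomb1234_compatible.
apply: iff_trans (interchangeable_compatible _ _) _.
split=> -[starA starP]; split=> //.
  have [|a [b [c eq_star]]] := compatible_lincomb n_ge3 starP (fun=> erefl).
    by lia.
  by exists a, b, c => x y; rewrite lincomb123_1234.
case: starP => a [b [c eq_star]].
apply: (eq_compatible (g := lincomb1234 a b c 0)).
  by move=> x y; rewrite eq_star lincomb123_1234.
exact: lincomb1234_compatible.
Qed.
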